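(* Let $m,n,s,k$ be integers with $m+s\ge n\ge s\ge 0$ and $k\le n$. Let $A\in\mathbb{R}^{m\times n}$, $B\in\mathbb{R}^{s\times n}$, $b\in\mathbb{R}^m$, $d\in\mathbb{R}^s$ satisfy $\mathrm{rank}(B)=s$ and $\mathrm{null}(A)\cap\mathrm{null}(B)=\{0\}$, let $L\in\mathbb{R}^{n\times k}$, and let $\alpha_A,\alpha_B,\alpha_b,\alpha_d>0$. Let $x=x(A,B,b,d)$ be the unique solution of $\min_{Bx=d}\|b-Ax\|_2$ and $r=b-Ax$. Then the partial condition number with respect to $L$ (defined in the context) satisfies $$\kappa_{LSE}(A,B,b,d)=\|M_{g'}\|_2,\qquad M_{g'}=[M_1,M_2,M_3,M_4],$$ where $$M_1=\frac{\left(r^T\otimes (L^T((AP)^TAP)^\dagger)\right)\Pi_{mn}-x^T\otimes(L^T(AP)^\dagger)}{\alpha_A},$$ $$M_2=-\frac{\left((r^TAB_A^\dagger)\otimes(L^T((AP)^TAP)^\dagger)\right)\Pi_{sn}+x^T\otimes(L^TB_A^\dagger)}{\alpha_B},$$ $$M_3=\frac{L^T(AP)^\dagger}{\alpha_b},\qquad M_4=\frac{L^TB_A^\dagger}{\alpha_d}.$$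
   Context: For a matrix $C$, $C^\dagger$ is the Moore-Penrose inverse, $\|C\|_2$ the spectral norm and $\|C\|_F$ the Frobenius norm; $\otimes$ is the Kronecker product. $P=I_n-B^\dagger B$ and $B_A^\dagger=(I_n-(AP)^\dagger A)B^\dagger$. The vec operator stacks the columns of a matrix into one vector. $\Pi_{pq}$ denotes the vec-permutation matrix, i.e. the $pq\times pq$ permutation matrix with $\Pi_{pq}\,\mathrm{vec}(Y)=\mathrm{vec}(Y^T)$ for all $Y\in\mathbb{R}^{p\times q}$. Under the rank conditions $\mathrm{rank}(B)=s$, $\mathrm{null}(A)\cap\mathrm{null}(B)=\{0\}$, the problem $\min_{Bx=d}\|b-Ax\|_2$ has the unique solution $x(A,B,b,d)=(AP)^\dagger b+B_A^\dagger d$. Define $g(A,B,b,d)=L^Tx(A,B,b,d)\in\mathbb{R}^k$; $g$ is continuously Fréchet differentiable in a neighborhood of $(A,B,b,d)$ in $\mathbb{R}^{m\times n}\times\mathbb{R}^{s\times n}\times\mathbb{R}^m\times\mathbb{R}^s$, and $g'(A,B,b,d)$ denotes its Fréchet derivative (a linear map) there. The weighted Frobenius norm is $$\|(\alpha_A\Delta A,\alpha_B\Delta B,\alpha_b\Delta b,\alpha_d\Delta d)\|_F=\sqrt{\alpha_A^2\|\Delta A\|_F^2+\alpha_B^2\|\Delta B\|_F^2+\alpha_b^2\|\Delta b\|_2^2+\alpha_d^2\|\Delta d\|_2^2}.$$ The partial condition number with respect to $L$ is $$\kappa_{LSE}(A,B,b,d)=\max_{(\Delta A,\Delta B,\Delta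 b,\Delta d)\ne0}\frac{\|g'(A,B,b,d)(\Delta A,\Delta B,\Delta b,\Delta d)\|_2}{\|(\alpha_A\Delta A,\alpha_B\Delta B,\alpha_b\Delta b,\alpha_d\Delta d)\|_F},$$ the maximum being over all $\Delta A\in\mathbb{R}^{m\times n}$, $\Delta B\in\mathbb{R}^{s\times n}$, $\Delta b\in\mathbb{R}^m$, $\Delta d\in\mathbb{R}^s$ not all zero. *)

(* Defs.v *)
From HB Require Import structures.
From mathcomp Require Import all_boot all_order all_algebra.
From mathcomp Require Import all_classical all_reals all_analysis.
From mathcomp Require Export mxtens.
From mathcomp Require Import ring.

Set Implicit Arguments.
Unset Strict Implicit.
Unset Printing Implicit Defensive.

Import Order.TTheory GRing.Theory Num.Theory.
Import numFieldNormedType.Exports.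

Local Open Scope classical_set_scope.
Local Open Scope ring_scope.

Definition norm2 (R : realType) (n : nat) (v : 'cV[R]_n) : R :=
  Num.sqrt (\sum_i v i 0 ^+ 2).

Definition normF (R : realType) (m n : nat) (C : 'M[R]_(m, n)) : R :=
  Num.sqrt (\sum_i \sum_j C i j ^+ 2).

(* [0] if the set has no largest element. *)
Definition max_of (R : realType) (S : set R) : R := xget 0 (S `&` ubound S).

(* For [n > 0] the maximum exists and is the square root of the largest
   eigenvalue of [C^T C]: see [specnorm_max] and [specnorm_eigenvalue].
   For [n = 0] it is [0]. *)
Definition specnorm (R : realType) (m n : nat) (C : 'M[R]_(m, n)) : R :=
  max_of [set norm2 (C *m v) / norm2 v | v in [set v : 'cV[R]_n | v != 0]].

Definition is_mpinv (R : realType) (m n : nat)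
    (C : 'M[R]_(m, n)) (X : 'M[R]_(n, m)) : Prop :=
  [/\ C *m X *m C = C, X *m C *m X = X,
      (C *m X)^T = C *m X & (X *m C)^T = X *m C].

(* Exactly one [X] satisfies [is_mpinv C X]: see [mpinvP] and [is_mpinv_uniq]. *)
Definition mpinv (R : realType) (m n : nat) (C : 'M[R]_(m, n)) : 'M[R]_(n, m) :=
  xget 0 [set X | is_mpinv C X].

Definition null (R : realType) (m n : nat) (C : 'M[R]_(m, n)) : set 'cV[R]_n :=
  [set x | C *m x = 0].

(* Column stacking: [Y i j] is entry number [j * p + i]. *)
Definition vec (R : realType) (p q : nat) (Y : 'M[R]_(p, q)) : 'cV[R]_(q * p) :=
  \col_k Y (mxtens_unindex k).2 (mxtens_unindex k).1.

(* Characterised by [vec_permP] and [vec_perm_uniq]. *)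
Definition vec_perm (R : realType) (p q : nat) : 'M[R]_(p * q, q * p) :=
  \matrix_(k, l) (mxtens_unindex k == ((mxtens_unindex l).2, (mxtens_unindex l).1))%:R.

(* The Kronecker product [u *t C] of a row and a matrix, with its number of
   rows [1 * k] cast to [k]. *)
Definition kron_row (R : realType) (p k q : nat)
    (u : 'rV[R]_p) (C : 'M[R]_(k, q)) : 'M[R]_(k, p * q) :=
  castmx (mul1n k, erefl (p * q)%N) (u *t C).

Definition nullproj (R : realType) (s n : nat) (B : 'M[R]_(s, n)) : 'M[R]_n :=
  1%:M - mpinv B *m B.

Definition mpinvBA (R : realType) (m n s : nat)
    (A : 'M[R]_(m, n)) (B : 'M[R]_(s, n)) : 'M[R]_(n, s) :=
  (1%:M - mpinv (A *m nullproj B) *m A) *m mpinv B.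

Definition lse_solutions (R : realType) (m n s : nat)
    (A : 'M[R]_(m, n)) (B : 'M[R]_(s, n)) (b : 'cV[R]_m) (d : 'cV[R]_s) :
    set 'cV[R]_n :=
  [set x | B *m x = d /\
     forall y : 'cV[R]_n, B *m y = d ->
       norm2 (b - A *m x) <= norm2 (b - A *m y)].

Definition lse_sol (R : realType) (m n s : nat)
    (A : 'M[R]_(m, n)) (B : 'M[R]_(s, n)) (b : 'cV[R]_m) (d : 'cV[R]_s) :
    'cV[R]_n :=
  xget 0 (lse_solutions A B b d).

Definition lse_g (R : realType) (m n s k : nat) (L : 'M[R]_(n, k))
    (p : 'M[R]_(m, n) * 'M[R]_(s, n) * 'cV[R]_m * 'cV[R]_s) : 'cV[R]_k :=
  let: (A, B, b, d) := p in L^T *m lse_sol A B b d.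

Definition wnormF (R : realType) (m n s : nat) (aA aB ab ad : R)
    (p : 'M[R]_(m, n) * 'M[R]_(s, n) * 'cV[R]_m * 'cV[R]_s) : R :=
  let: (dA, dB, db, dd) := p in
  Num.sqrt (aA ^+ 2 * normF dA ^+ 2 + aB ^+ 2 * normF dB ^+ 2 +
            ab ^+ 2 * norm2 db ^+ 2 + ad ^+ 2 * norm2 dd ^+ 2).

Definition kappa_LSE (R : realType) (m n s k : nat) (L : 'M[R]_(n, k))
    (aA aB ab ad : R) (A : 'M[R]_(m, n)) (B : 'M[R]_(s, n))
    (b : 'cV[R]_m) (d : 'cV[R]_s) : R :=
  max_of [set norm2 ('d (lse_g L) (A, B, b, d) p) / wnormF aA aB ab ad p |
          p in [set p : 'M[R]_(m, n) * 'M[R]_(s, n) * 'cV[R]_m * 'cV[R]_s |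
                p != 0]].

Lemma max_ofP (R : realType) (S : set R) (v : R) :
  S v -> ubound S v -> max_of S = v.
Proof.
move=> Sv uv; apply: xget_unique; first by split.
by move=> w [Sw uw]; apply/eqP; rewrite eq_le uv //= uw.
Qed.

Lemma mulmx_trE (R : realType) (n : nat) (v w : 'cV[R]_n) :
  (v^T *m w) 0 0 = \sum_i v i 0 * w i 0.
Proof. by rewrite mxE; apply: eq_bigr => i _; rewrite mxE. Qed.

Lemma sqr_norm2 (R : realType) (n : nat) (v : 'cV[R]_n) :
  norm2 v ^+ 2 = (v^T *m v) 0 0.
Proof.
rewrite sqr_sqrtr ?sumr_ge0// => [|i _]; last exact: sqr_ge0.
by rewrite mulmx_trE; apply: eq_bigr => i _; rewrite expr2.
Qed.

Lemma norm2_eq0 (R : realType) (n : nat) (v : 'cV[R]_n) :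
  (norm2 v == 0) = (v == 0).
Proof.
apply/idP/eqP => [|->]; last first.
  by rewrite /norm2 big1 ?sqrtr0// => i _; rewrite mxE expr0n.
rewrite -sqrf_eq0 sqr_norm2 mulmx_trE => /eqP h.
have/psumr_eq0P h' : \sum_i v i 0 * v i 0 = 0 by [].
apply/matrixP => i j; rewrite ord1 mxE; apply/eqP.
rewrite -sqrf_eq0 expr2; apply/eqP; apply: h' => // k _.
by rewrite -expr2 sqr_ge0.
Qed.

Lemma norm2_ge0 (R : realType) (n : nat) (v : 'cV[R]_n) : 0 <= norm2 v.
Proof. exact: sqrtr_ge0. Qed.

Lemma norm2Z (R : realType) (n : nat) (a : R) (v : 'cV[R]_n) :
  norm2 (a *: v) = `|a| * norm2 v.
Proof.
apply/eqP; rewrite -(@eqrXn2 _ 2)// ?norm2_ge0 ?mulr_ge0 ?norm2_ge0//.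
rewrite exprMn real_normK ?num_real// !sqr_norm2 !mulmx_trE mulr_sumr.
by apply/eqP; apply: eq_bigr => i _; rewrite !mxE mulrACA expr2.
Qed.

Lemma gram_unit (R : realType) (r n : nat) (G : 'M[R]_(r, n)) :
  row_free G -> G *m G^T \in unitmx.
Proof.
move=> Gf; rewrite -row_free_unit -kermx_eq0; apply/rowV0P => v /sub_kermxP h.
have : norm2 (v *m G)^T ^+ 2 = 0.
  by rewrite sqr_norm2 trmxK trmx_mul mulmxA -(mulmxA v) h mul0mx mxE.
move/eqP; rewrite sqrf_eq0 norm2_eq0 => /eqP/(congr1 trmx).
rewrite trmxK trmx0 => /eqP; rewrite mulmx_free_eq0// => /eqP //.
Qed.

Lemma is_mpinv_mul (R : realType) (m r n : nat)
    (F : 'M[R]_(m, r)) (G : 'M[R]_(r, n)) :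
  F^T *m F \in unitmx -> G *m G^T \in unitmx ->
  is_mpinv (F *m G)
    (G^T *m invmx (G *m G^T) *m invmx (F^T *m F) *m F^T).
Proof.
move=> Fu Gu; set Gi := invmx (G *m G^T); set Fi := invmx (F^T *m F).
have CX : F *m G *m (G^T *m Gi *m Fi *m F^T) = F *m Fi *m F^T.
  by rewrite !mulmxA -(mulmxA F G) -(mulmxA F) mulmxV// mulmx1.
have XC : (G^T *m Gi *m Fi *m F^T) *m (F *m G) = G^T *m Gi *m G.
  by rewrite !mulmxA -(mulmxA _ F^T) -(mulmxA _ Fi) mulVmx// mulmx1.
have FiT : Fi^T = Fi by rewrite trmx_inv trmx_mul trmxK.
have GiT : Gi^T = Gi by rewrite trmx_inv trmx_mul trmxK.
split.
- by rewrite CX !mulmxA -(mulmxA _ F^T) -(mulmxA _ Fi) mulVmx// mulmx1.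
- by rewrite XC !mulmxA -(mulmxA _ G) -(mulmxA _ (G *m _)) mulmxV// mulmx1.
- by rewrite CX !trmx_mul trmxK FiT mulmxA.
- by rewrite XC !trmx_mul trmxK GiT mulmxA.
Qed.

Lemma is_mpinv_ex (R : realType) (m n : nat) (C : 'M[R]_(m, n)) :
  exists X, is_mpinv C X.
Proof.
eexists; rewrite -{1}(mulmx_base C); apply: is_mpinv_mul.
- rewrite -{2}[col_base C]trmxK; apply: gram_unit.
  rewrite -row_leq_rank mxrank_tr; move: (col_base_full C).
  by rewrite -col_leq_rank.
- by apply: gram_unit; exact: row_base_free.
Qed.

Lemma mpinvP (R : realType) (m n : nat) (C : 'M[R]_(m, n)) : is_mpinv C (mpinv C).
Proof. by have [X hX] := is_mpinv_ex C; exact: (xgetPex 0 (ex_intro _ X hX)). Qed.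

Lemma is_mpinv_uniq (R : realType) (m n : nat) (C : 'M[R]_(m, n)) X Y :
  is_mpinv C X -> is_mpinv C Y -> X = Y.
Proof.
move=> [x1 x2 x3 x4] [y1 y2 y3 y4].
have e1 : C *m X = C *m Y.
  by rewrite -{1}y1 -(mulmxA (C *m Y)) -y3 -x3 -trmx_mul mulmxA x1.
have e2 : X *m C = Y *m C.
  by rewrite -{1}y1 -!mulmxA mulmxA -x4 -y4 -trmx_mul -!mulmxA (mulmxA C) x1.
by rewrite -x2 -mulmxA e1 mulmxA e2 y2.
Qed.

Lemma vec_permP (R : realType) (p q : nat) (Y : 'M[R]_(p, q)) :
  vec_perm R p q *m vec Y = vec Y^T.
Proof.
apply/matrixP => k j; rewrite !mxE ord1.
case: (mxtens_indexP k) => i l; rewrite mxtens_indexK /=.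
rewrite (bigD1 (mxtens_index (l, i)))//= !mxE !mxtens_indexK /= eqxx mul1r.
rewrite big1 ?addr0// => t; case: (mxtens_indexP t) => a c ht.
rewrite !mxE !mxtens_indexK /= (_ : _ == _ = false) ?mul0r//.
by apply: contraNF ht => /eqP[-> ->].
Qed.

Lemma vec_perm_uniq (R : realType) (p q : nat) (Q : 'M[R]_(p * q, q * p)) :
  (forall Y : 'M[R]_(p, q), Q *m vec Y = vec Y^T) -> Q = vec_perm R p q.
Proof.
move=> h; apply/matrixP => k l.
pose Y : 'M[R]_(p, q) := \matrix_(i, j) (l == mxtens_index (j, i))%:R.
have E (M : 'M[R]_(p * q, q * p)) : M k l = (M *m vec Y) k 0.
  rewrite mxE (bigD1 l)//= !mxE -surjective_pairing mxtens_unindexK.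
  rewrite eqxx mulr1 big1 ?addr0// => t; rewrite !mxE -surjective_pairing.
  by rewrite mxtens_unindexK eq_sym => /negbTE ->; rewrite mulr0.
by rewrite E h -vec_permP -E.
Qed.

Lemma continuous_sqr_norm2_mul (R : realType) (m n : nat) (C : 'M[R]_(m, n)) :
  continuous (fun v : 'rV[R]_n => norm2 (C *m v^T) ^+ 2).
Proof.
have csum (I : Type) (s : seq I) (F : I -> 'rV[R]_n -> R) :
    (forall i, continuous (F i)) -> continuous (fun v => \sum_(i <- s) F i v).
  move=> cF; elim: s => [|i s IH] v.
    rewrite (_ : (fun _ => _) = cst 0); first exact: cst_continuous.
    by apply/funext => w; rewrite big_nil.
  rewrite (_ : (fun _ => _) = fun w => F i w + \sum_(j <- s) F j w); last first.
    by apply/funext => w; rewrite big_cons.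
  by apply: continuousD; [exact: cF | exact: IH].
pose F i (v : 'rV[R]_n) : R := \sum_j C i j * v 0 j.
rewrite (_ : (fun v => _) = fun v => \sum_i F i v * F i v); last first.
  apply/funext => v; rewrite sqr_norm2 mulmx_trE; apply: eq_bigr => i _.
  by rewrite mxE; under eq_bigr do rewrite mxE.
have cF i : continuous (F i).
  apply: csum => j v; apply: continuousM; first exact: cst_continuous.
  exact: coord_continuous.
by apply: csum => i v; apply: continuousM; exact: cF.
Qed.

Lemma specnorm_max (R : realType) (m n : nat) (C : 'M[R]_(m, n)) :
  (0 < n)%N ->
  (exists2 v, v != 0 & norm2 (C *m v) = specnorm C * norm2 v) /\
  (forall v, norm2 (C *m v) <= specnorm C * norm2 v).
Proof.
move=> n0.
pose S := [set v : 'rV[R]_n | norm2 (1%:M *m v^T) ^+ 2 = 1].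
have n2gt0 (v : 'cV[R]_n) : v != 0 -> 0 < norm2 v.
  by move=> v0; rewrite lt_def norm2_ge0 andbT norm2_eq0.
have normS (v : 'cV[R]_n) : v != 0 -> S ((norm2 v)^-1 *: v)^T.
  move=> v0; rewrite /S /= trmxK mul1mx norm2Z normfV ger0_norm ?norm2_ge0//.
  by rewrite mulVf ?expr1n ?norm2_eq0.
have cS : compact S.
  have clS : closed S.
    apply: (@preimage_closed _ _ (fun v : 'rV[R]_n => norm2 (1%:M *m v^T) ^+ 2)
      [set 1]); last exact: closed_eq.
    by move=> v _; exact: continuous_sqr_norm2_mul.
  have cI : compact [set v : 'rV[R]_n | forall i, `[(-1 : R), 1]%classic (v 0 i)].
    by apply: (@rV_compact _ _ (fun=> `[(-1 : R), 1]%classic)) => _;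
      exact: segment_compact.
  apply: subclosed_compact clS cI _ => v; rewrite /S /= mul1mx sqr_norm2 mulmx_trE => h i.
  rewrite in_itv/= -ler_norml -(@ler_pXn2r _ 2)// ?nnegrE// expr1n.
  rewrite real_normK ?num_real// -h (bigD1 i)//= mxE expr2 lerDl sumr_ge0// => j _.
  by rewrite mxE -expr2 sqr_ge0.
have S0 : S !=set0.
  exists ((norm2 (const_mx 1 : 'cV[R]_n))^-1 *: const_mx 1)^T; apply: normS.
  apply/eqP => /matrixP/(_ (Ordinal n0) 0); rewrite !mxE => /eqP.
  by rewrite oner_eq0.
have [c cS' cmax] := EVT_max_rV S0 cS
  (continuous_subspaceT (@continuous_sqr_norm2_mul _ _ _ C)).
move: cS'; rewrite inE => cS'.
have nc : norm2 c^T = 1.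
  move: cS'; rewrite /S /= mul1mx => /eqP; rewrite sqrf_eq1 => /orP[/eqP//|].
  move=> /eqP h; have := norm2_ge0 c^T; by rewrite h oppr_ge0 ler10.
have c0 : c^T != 0 by rewrite -norm2_eq0 nc oner_eq0.
have key v : norm2 (C *m v) <= norm2 (C *m c^T) * norm2 v.
  have [->|v0] := eqVneq v 0.
    have z k : norm2 (0 : 'cV[R]_k) = 0 by apply/eqP; rewrite norm2_eq0.
    by rewrite mulmx0 !z mulr0.
  have := cmax _ (mem_set (normS _ v0)).
  rewrite trmxK -scalemxAr norm2Z normfV (ger0_norm (norm2_ge0 v)).
  rewrite ler_pXn2r ?nnegrE ?mulr_ge0 ?invr_ge0 ?norm2_ge0//.
  by rewrite ler_pdivrMl ?n2gt0// mulrC.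
have E : specnorm C = norm2 (C *m c^T).
  apply: max_ofP; first by exists c^T => //=; rewrite nc divr1.
  by move=> _ [v /= v0 <-]; rewrite ler_pdivrMr ?n2gt0.
by rewrite E; split=> //; exists c^T => //; rewrite nc mulr1.
Qed.

Lemma specnorm_eigenvalue (R : realType) (m n : nat) (C : 'M[R]_(m, n)) :
  (0 < n)%N ->
  eigenvalue (C^T *m C) (specnorm C ^+ 2) /\
  (forall a, eigenvalue (C^T *m C) a -> a <= specnorm C ^+ 2).
Proof.
move=> n0; have [[v v0 vE] le] := specnorm_max C n0.
have s0 : 0 <= specnorm C.
  have := norm2_ge0 (C *m v); rewrite vE pmulr_lge0//.
  by rewrite lt_def norm2_ge0 andbT norm2_eq0.
have le2 w : norm2 (C *m w) ^+ 2 <= specnorm C ^+ 2 * norm2 w ^+ 2.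
  by rewrite -exprMn ler_pXn2r ?nnegrE ?mulr_ge0 ?norm2_ge0.
set l := specnorm C ^+ 2 in le2 *.
pose H := l%:M - C^T *m C.
have HE (u w : 'cV[R]_n) : (u^T *m H *m w) 0 0 = l * (u^T *m w) 0 0 - ((C *m u)^T *m (C *m w)) 0 0.
  by rewrite mulmxBr mulmxBl mul_mx_scalar -scalemxAl trmx_mul !mulmxA !mxE.
have HT : H^T = H by rewrite linearB /= tr_scalar_mx trmx_mul trmxK.
have q0 (w : 'cV[R]_n) : 0 <= (w^T *m H *m w) 0 0.
  by rewrite HE subr_ge0; have := le2 w; rewrite !sqr_norm2.
have qv : (v^T *m H *m v) 0 0 = 0.
  apply/eqP; rewrite HE subr_eq0; have := congr1 (fun x => x ^+ 2) vE.
  by rewrite /= exprMn !sqr_norm2 => ->.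
have HM : H *m v = l *: v - C^T *m C *m v by rewrite mulmxBl mul_scalar_mx.
clearbody H.
have Hv : H *m v = 0.
  apply/eqP; rewrite -norm2_eq0 -sqrf_eq0 sqr_norm2.
  set w := H *m v.
  set c := (w^T *m w) 0 0; set a := (w^T *m H *m w) 0 0.
  have q t : 0 <= a * t ^+ 2 + c * t *+ 2.
    have := q0 (v + t *: w).
    have -> : (v + t *: w)^T = v^T + t *: w^T by rewrite linearD linearZ.
    rewrite !(mulmxDl, mulmxDr) -!(scalemxAl, scalemxAr).
    have e1 : v^T *m H *m w = w^T *m w by rewrite /w trmx_mul HT.
    have e2 : w^T *m H *m v = w^T *m w by rewrite /w -mulmxA.
    have D (X Y : 'M[R]_1) : (X + Y) 0 0 = X 0 0 + Y 0 0 by rewrite mxE.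
    have Z (k : R) (X : 'M[R]_1) : (k *: X) 0 0 = k * X 0 0 by rewrite mxE.
    rewrite e1 e2 !(D, Z) qv add0r -/c -/a.
    by rewrite (_ : _ + _ = a * t ^+ 2 + c * t *+ 2)//; ring.
  have a0 : 0 <= a := q0 w.
  have a1 : 0 < a + 1 by rewrite ltr_wpDl.
  have := q (- c / (a + 1)).
  rewrite (_ : _ + _ = - (c ^+ 2 * ((a + 2) / (a + 1) ^+ 2))); last first.
    by field; rewrite gt_eqF.
  rewrite oppr_ge0 pmulr_lle0; last first.
    by rewrite divr_gt0 ?exprn_gt0// ltr_wpDl.
  by move=> c2; rewrite -sqrf_eq0 eq_le c2 sqr_ge0.
split.
  apply/eigenvalueP; exists v^T; last by rewrite trmx_eq0.
  apply: trmx_inj; rewrite trmx_mul trmxK linearZ /= trmx_mul !trmxK.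
  by move/eqP: Hv; rewrite HM subr_eq0 => /eqP.
move=> a /eigenvalueP[w wE w0].
have w0' : w^T != 0 by rewrite trmx_eq0.
have n2gt0 : 0 < norm2 w^T ^+ 2 by rewrite exprn_gt0// lt_def norm2_ge0 norm2_eq0 w0'.
rewrite -(ler_pM2r n2gt0); apply: le_trans (le2 _).
rewrite [leRHS]sqr_norm2 trmx_mul trmxK !mulmxA -(mulmxA w) wE -scalemxAl mxE.
by rewrite sqr_norm2 trmxK.
Qed.

(* Main.v *)
Require Import Defs.
From HB Require Import structures.
From mathcomp Require Import all_boot all_order all_algebra.
From mathcomp Require Import all_classical all_reals all_analysis.
From mathcomp Require Import ring lra.

Set Implicit Arguments.
Unset Strict Implicit.
Unset Printing Implicit Defensive.

Import Order.TTheory GRing.Theory Num.Theory.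
Import numFieldNormedType.Exports.

Local Open Scope classical_set_scope.
Local Open Scope ring_scope.

(* The solution x is a block of the solution z = (r, l, x) of the augmented
   system K z = (b, d, 0), with r + A x = b, B x = d and A^T r + B^T l = 0. Its
   matrix K is affine in (A, B) and invertible under the rank conditions, hence
   also nearby, so that the derivative of z is K^-1 ((db, dd, 0) - dK z). The
   x-block of K^-1 (f, g, q) is
     (AP)^+ f + B_A^+ g - ((AP)^T AP)^+ q,
   and l = - (A B_A^+)^T r. Vectorizing, g' is M_g' composed with the weighted
   vectorization, which is a linear isometry from the weighted Frobenius norm
   onto the Euclidean norm: both sides are the maximum of the same set. *)

(** * Estimates in the entrywise maximum norm of matrices *)

Lemma ler_normr_mx (R : realType) (m n : nat) (M : 'M[R]_(m, n)) (c : R) :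
  0 <= c -> (forall i j, `|M i j| <= c) -> `|M| <= c.
Proof.
move=> c0 h; rewrite /Num.Def.normr/= mx_normrE.
by apply: bigmax_le => // -[i j] _; exact: h.
Qed.

Lemma normr_mx_entry (R : realType) (m n : nat) (M : 'M[R]_(m, n)) i j :
  `|M i j| <= `|M|.
Proof.
rewrite [leRHS]/Num.Def.normr/= mx_normrE.
exact: (le_bigmax _ (fun ij => `|M ij.1 ij.2|) (i, j)).
Qed.

(** The maximum norm is not submultiplicative: the factor [n] counts the terms of each entry of the
    product. *)
Lemma normr_mulmx (R : realType) (m n p : nat) (M : 'M[R]_(m, n)) (N : 'M[R]_(n, p)) :
  `|M *m N| <= n%:R * `|M| * `|N|.
Proof.
apply: ler_normr_mx => [|i j]; first by rewrite !mulr_ge0.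
rewrite mxE; apply: le_trans (ler_norm_sum _ _ _) _.
apply: (@le_trans _ _ (\sum_(k < n) `|M| * `|N|)).
  by apply: ler_sum => k _; rewrite normrM ler_pM ?normr_mx_entry.
by rewrite sumr_const card_ord -[leLHS]mulr_natl mulrA.
Qed.

Lemma normr_trmx (R : realType) (m n : nat) (M : 'M[R]_(m, n)) : `|M^T| <= `|M|.
Proof. by apply: ler_normr_mx => // i j; rewrite mxE normr_mx_entry. Qed.

Lemma normr_col_mx (R : realType) (m1 m2 n : nat)
    (M : 'M[R]_(m1, n)) (N : 'M[R]_(m2, n)) (c : R) :
  `|M| <= c -> `|N| <= c -> `|col_mx M N| <= c.
Proof.
move=> Mc Nc; apply: ler_normr_mx => [|i j]; first exact: le_trans Mc.
by rewrite mxE; case: fintype.split => k; apply: le_trans (normr_mx_entry _ _ _) _.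
Qed.

Lemma normr_row_mx (R : realType) (m n1 n2 : nat)
    (M : 'M[R]_(m, n1)) (N : 'M[R]_(m, n2)) (c : R) :
  `|M| <= c -> `|N| <= c -> `|row_mx M N| <= c.
Proof.
move=> Mc Nc; rewrite -[row_mx M N]trmxK; apply: le_trans (normr_trmx _) _.
by rewrite tr_row_mx normr_col_mx// (le_trans (normr_trmx _)).
Qed.

Lemma normr_dsubmx (R : realType) (m1 m2 n : nat) (M : 'M[R]_(m1 + m2, n)) :
  `|dsubmx M| <= `|M|.
Proof. by apply: ler_normr_mx => // i j; rewrite mxE normr_mx_entry. Qed.

(** * First-order perturbation of an invertible linear system *)

Lemma unitmx_ker0 (R : realType) (n : nat) (K : 'M[R]_n) :
  (forall v : 'cV_n, K *m v = 0 -> v = 0) -> K \in unitmx.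
Proof.
move=> K0; rewrite -unitmx_tr -row_free_unit -kermx_eq0; apply/rowV0P => v.
move=> /sub_kermxP/(congr1 trmx); rewrite trmx_mul trmxK trmx0 => /K0 h.
by rewrite -[v]trmxK h trmx0.
Qed.

(* With [w = z' - z] the equation reads [K w = e - E z - E w]; bounding [w] by
   absorption makes the last term quadratic. *)
Lemma linear_system_perturbation (R : realType) (n : nat) (K : 'M[R]_n) (z : 'cV[R]_n) :
  K \in unitmx ->
  exists2 c : R, 0 < c & forall (E : 'M[R]_n) (e : 'cV[R]_n) (t : R),
    `|E| <= t -> `|e| <= t -> c * t <= 1 ->
    K + E \in unitmx /\
    forall z', (K + E) *m z' = K *m z + e ->
      `|z' - (z + invmx K *m (e - E *m z))| <= c * t ^+ 2.
Proof.
(* Here [a] bounds [invmx K] as an operator and [q * t] will bound [e - E *m z]. In [c] the second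
   summand keeps [K + E] invertible, the third is the constant of the quadratic error, and 1 makes
   [c] positive. *)
move=> Ku; pose N : R := n%:R; pose a : R := N * `|invmx K|.
pose q : R := 1 + N * `|z|; pose c : R := 1 + 2 * a * N + 2 * a ^+ 2 * N * q.
have N0 : 0 <= N by exact: ler0n.
have a0 : 0 <= a by rewrite mulr_ge0.
have q0 : 0 <= q by rewrite addr_ge0// mulr_ge0.
have aN := mulr_ge0 a0 N0; have aNq := mulr_ge0 (mulr_ge0 (sqr_ge0 a) N0) q0.
have c1 : 2 * a * N <= c by rewrite /c; nra.
have c2 : 2 * a ^+ 2 * N * q <= c by rewrite /c; nra.
exists c; first by rewrite /c; nra.
move=> E e t Et et ct.
have t0 : 0 <= t := le_trans (normr_ge0 _) Et.
have KN (v : 'cV[R]_n) : `|invmx K *m v| <= a * `|v| by exact: normr_mulmx.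
have EN (v : 'cV[R]_n) : `|E *m v| <= N * t * `|v|.
  by apply: le_trans (normr_mulmx _ _) _; rewrite ler_wpM2r// ler_wpM2l.
have KEN (v : 'cV[R]_n) : `|invmx K *m (E *m v)| <= a * N * t * `|v|.
  by apply: le_trans (KN _) _; rewrite -(mulrA a) -(mulrA a) ler_wpM2l// EN.
have half : a * N * t <= 2^-1.
  have := ler_wpM2r t0 c1; lra.
(* Applying [invmx K] gives [|v| <= a * |u| + |v| / 2]; the last term is absorbed on the left. *)
have absorb (u v : 'cV[R]_n) : K *m v = u - E *m v -> `|v| <= 2 * a * `|u|.
  move=> /(congr1 (mulmx (invmx K))); rewrite mulKmx// mulmxBr => h.
  have : `|v| <= a * `|u| + 2^-1 * `|v|.
    rewrite {1}h; apply: le_trans (ler_normB _ _) _; rewrite lerD ?KN//.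
    by apply: le_trans (KEN _) _; rewrite ler_wpM2r.
  by lra.
split.
  (* A kernel vector of [K + E] falls under the absorption bound with [u = 0]. *)
  apply: unitmx_ker0 => v; rewrite mulmxDl => /eqP; rewrite addr_eq0 => /eqP h.
  by apply/eqP; rewrite -normr_le0 (le_trans (absorb 0 v _))// ?h ?sub0r// normr0 mulr0.
move=> z' h; set w := z' - z; set u := e - E *m z.
have Kw : K *m w = u - E *m w.
  rewrite /w /u !mulmxBr opprB addrA subrK.
  have -> : e = K *m z' + E *m z' - K *m z by rewrite -mulmxDl h addrAC subrr add0r.
  by rewrite [RHS]addrAC addrK.
have ub : `|u| <= q * t.
  apply: le_trans (ler_normB _ _) _; rewrite /q mulrDl mul1r lerD//.
  by rewrite mulrAC; exact: EN.
have wb : `|w| <= 2 * a * (q * t).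
  by apply: le_trans (absorb _ _ Kw) _; rewrite ler_wpM2l// mulr_ge0.
(* The error is exactly the image of [E *m w], a product of two factors of order [t]. *)
have -> : z' - (z + invmx K *m u) = - (invmx K *m (E *m w)).
  by rewrite opprD addrA -/w -{1}[w](mulKmx Ku) Kw mulmxBr addrAC subrr sub0r.
rewrite normrN; apply: le_trans (KEN _) _.
apply: (@le_trans _ _ (a * N * t * (2 * a * (q * t)))).
  by rewrite ler_wpM2l// !mulr_ge0.
rewrite (_ : _ * _ = 2 * a ^+ 2 * N * q * t ^+ 2); last by ring.
by rewrite ler_wpM2r// sqr_ge0.
Qed.

(** * The projector [P] onto the null space of [B] and the pseudoinverse of [AP] *)

Lemma nullproj_mulB (R : realType) (s n : nat) (B : 'M[R]_(s, n)) :
  B *m nullproj B = 0.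
Proof.
have [e _ _ _] := mpinvP B.
by rewrite /nullproj mulmxBr mulmx1 mulmxA e subrr.
Qed.

Lemma nullproj_tr (R : realType) (s n : nat) (B : 'M[R]_(s, n)) :
  (nullproj B)^T = nullproj B.
Proof. by have [_ _ _ e] := mpinvP B; rewrite /nullproj linearB /= trmx1 e. Qed.

Lemma nullproj_idem (R : realType) (s n : nat) (B : 'M[R]_(s, n)) :
  nullproj B *m nullproj B = nullproj B.
Proof.
by rewrite {1}/nullproj mulmxBl mul1mx -mulmxA nullproj_mulB mulmx0 subr0.
Qed.

(** With X the pseudoinverse of C, both products of [X *m X^T] with [C^T *m C] collapse to the
    symmetric projector [X *m C], which gives the four Penrose equations. *)
Lemma mpinv_gram (R : realType) (m n : nat) (C : 'M[R]_(m, n)) :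
  mpinv (C^T *m C) = mpinv C *m (mpinv C)^T.
Proof.
have [e1 e2 e3 e4] := mpinvP C; set X := mpinv C in e1 e2 e3 e4 *.
have gX : C^T *m C *m (X *m X^T) = X *m C.
  by rewrite mulmxA -(mulmxA C^T) -e3 -trmx_mul e1 -trmx_mul e4.
have Xg : X *m X^T *m (C^T *m C) = X *m C.
  by rewrite mulmxA -(mulmxA X) -trmx_mul e3 !mulmxA e2.
apply: is_mpinv_uniq (mpinvP _) _; split; rewrite ?gX ?Xg //.
- by rewrite mulmxA -e4 -trmx_mul mulmxA e1.
- by rewrite mulmxA e2.
Qed.

Section ProjectedPseudoinverse.
Variables (R : realType) (m n s : nat) (A : 'M[R]_(m, n)) (B : 'M[R]_(s, n)).
Let P := nullproj B.
Let X := mpinv (A *m P).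

(** By the Penrose equations X = (AP)^T X^T X, and (AP)^T = P A^T has its range in that of the
    idempotent P. *)
Lemma nullproj_mpinv : P *m X = X.
Proof.
have [_ e2 _ e4] := mpinvP (A *m P); rewrite -/X in e2 e4.
have h : X = P *m (A^T *m X^T *m X).
  by rewrite -{1}e2 -e4 trmx_mul trmx_mul nullproj_tr !mulmxA.
by rewrite h mulmxA nullproj_idem.
Qed.

(** The pseudoinverse of the Gram matrix is X X^T, and X^T A^T = X^T P A^T = (AP X)^T = AP X; then X
    AP X = X. *)
Lemma mpinv_nullproj_gram_trA : mpinv ((A *m P)^T *m (A *m P)) *m A^T = X.
Proof.
have [_ e2 e3 _] := mpinvP (A *m P); rewrite -/X in e2 e3.
rewrite mpinv_gram -/X -{2}nullproj_mpinv trmx_mul -!mulmxA.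
by rewrite -trmx_mul -trmx_mul e3 mulmxA e2.
Qed.

(** Again X^T = X^T P, and P B^T = (B P)^T = 0. *)
Lemma mpinv_nullproj_gram_trB : mpinv ((A *m P)^T *m (A *m P)) *m B^T = 0.
Proof.
rewrite mpinv_gram -/X -{2}nullproj_mpinv trmx_mul -!mulmxA -trmx_mul.
by rewrite nullproj_mulB trmx0 !mulmx0.
Qed.

(** Every column of the difference of the two sides lies in both null spaces. *)
Lemma mpinv_nullproj_mul : null A `&` null B = [set 0] -> X *m A *m P = P.
Proof.
move=> hAB; have [e1 _ _ _] := mpinvP (A *m P); rewrite -/X in e1.
(* With [P] inserted before [X], the product with [A] reduces to AP X AP = AP and the product with
   [B] to B P = 0. *)
have PX : P *m (X *m (A *m P)) = X *m (A *m P) by rewrite mulmxA nullproj_mpinv.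
apply/eqP; rewrite -subr_eq0 -mulmxA; apply/eqP.
have AD : A *m (X *m (A *m P) - P) = 0.
  by rewrite mulmxBr -PX !mulmxA -(mulmxA (A *m P *m X)) e1 subrr.
have BD : B *m (X *m (A *m P) - P) = 0.
  by rewrite mulmxBr -PX !mulmxA nullproj_mulB !mul0mx subrr.
apply/matrixP => i j; set D := _ - P in AD BD *.
have : (null A `&` null B) (col j D).
  by split; rewrite /null /= !colE mulmxA ?AD ?BD mul0mx.
by rewrite hAB => /= /matrixP/(_ i 0); rewrite !mxE.
Qed.

End ProjectedPseudoinverse.

(** * The augmented system and its solution *)

(* The optimality conditions of the problem, in the unknowns
   (residual, multiplier, solution). *)
Definition kkt (R : realType) (m n s : nat) (A : 'M[R]_(m, n)) (B : 'M[R]_(s, n)) :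
    'M[R]_(m + s + n) :=
  block_mx (block_mx 1%:M 0 0 0) (col_mx A B) (row_mx A^T B^T) 0.

Definition kkt_rhs (R : realType) (m n s : nat) (b : 'cV[R]_m) (d : 'cV[R]_s) :
    'cV[R]_(m + s + n) :=
  col_mx (col_mx b d) 0.

(** The linear part of the affine map [kkt]: the constant identity block drops out of increments. *)
Definition kkt_dir (R : realType) (m n s : nat) (A : 'M[R]_(m, n)) (B : 'M[R]_(s, n)) :
    'M[R]_(m + s + n) :=
  block_mx 0 (col_mx A B) (row_mx A^T B^T) 0.

Section Kkt.
Variables (R : realType) (m n s : nat).
Implicit Types (A : 'M[R]_(m, n)) (B : 'M[R]_(s, n)) (b r : 'cV[R]_m)
  (d l : 'cV[R]_s) (x : 'cV[R]_n).

Lemma mul_kkt A B r l x :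
  kkt A B *m col_mx (col_mx r l) x =
  col_mx (col_mx (r + A *m x) (B *m x)) (A^T *m r + B^T *m l).
Proof.
rewrite /kkt !mul_block_col mul_row_col mul1mx !mul0mx !addr0 mul_col_mx.
by rewrite add_col_mx add0r.
Qed.

Lemma mul_kkt_dir A B r l x :
  kkt_dir A B *m col_mx (col_mx r l) x =
  col_mx (col_mx (A *m x) (B *m x)) (A^T *m r + B^T *m l).
Proof.
by rewrite /kkt_dir !mul_block_col mul_row_col mul_col_mx !mul0mx addr0 add0r.
Qed.

Lemma kktD A dA B dB : kkt (dA + A) (dB + B) = kkt A B + kkt_dir dA dB.
Proof.
rewrite /kkt /kkt_dir !add_block_mx add_col_mx add_row_mx !linearD /= !addr0.
by congr block_mx; rewrite ?(addrC A) ?(addrC B) ?(addrC A^T) ?(addrC B^T).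
Qed.

(** In the homogeneous system r^T r = - r^T A x = l^T B x = 0. Hence r = 0, so x lies in both null
    spaces and vanishes, and B^T l = 0 forces l = 0 by full row rank. *)
Lemma kkt_unit A B : \rank B = s -> null A `&` null B = [set 0] -> kkt A B \in unitmx.
Proof.
move=> hB hAB; apply: unitmx_ker0 => v.
rewrite -[v]vsubmxK -[usubmx v]vsubmxK.
set r := usubmx (usubmx v); set l := dsubmx (usubmx v); set x := dsubmx v.
rewrite mul_kkt => /eqP; rewrite !col_mx_eq0 => /andP[/andP[/eqP h1 /eqP h2] /eqP h3].
have r0 : r = 0.
  apply/eqP; rewrite -norm2_eq0 -sqrf_eq0 sqr_norm2; apply/eqP.
  have rT : r^T *m A = - (l^T *m B).
    apply: trmx_inj; rewrite linearN /= !trmx_mul !trmxK.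
    by apply/eqP; rewrite -addr_eq0 h3.
  have -> : r^T *m r = - (r^T *m A *m x).
    by rewrite -mulmxA -mulmxN; congr (_ *m _); apply/eqP; rewrite -addr_eq0 h1.
  by rewrite rT mulNmx opprK -mulmxA h2 mulmx0 mxE.
have x0 : x = 0.
  have : (null A `&` null B) x by split=> //; rewrite /null /=; move: h1; rewrite r0 add0r.
  by rewrite hAB.
have l0 : l = 0.
  have : row_free B by rewrite /row_free hB.
  move=> Bf; apply: trmx_inj; rewrite trmx0; apply/eqP.
  rewrite -(mulmx_free_eq0 _ Bf) -[B]trmxK -trmx_mul -trmx0; apply/eqP.
  by congr trmx; rewrite -h3 r0 mulmx0 add0r.
by rewrite r0 x0 l0 !col_mx0.
Qed.

Lemma sqr_norm2D_orth p (u v : 'cV[R]_p) :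
  u^T *m v = 0 -> norm2 (u + v) ^+ 2 = norm2 u ^+ 2 + norm2 v ^+ 2.
Proof.
move=> h; rewrite !sqr_norm2 [(u + v)^T]linearD /= mulmxDl !mulmxDr h.
have -> : v^T *m u = 0 by rewrite -[u]trmxK -trmx_mul h trmx0.
by rewrite addr0 add0r mxE.
Qed.

(** For feasible y, A (x - y) is orthogonal to r, because r^T A = - l^T B and B (x - y) = 0.
    Minimality of x follows by Pythagoras, uniqueness from the invertibility of [kkt A B]. *)
Lemma lse_sol_kkt A B b d r l x :
  kkt A B \in unitmx -> kkt A B *m col_mx (col_mx r l) x = kkt_rhs n b d ->
  lse_sol A B b d = x.
Proof.
move=> Ku; rewrite mul_kkt => /eq_col_mx[/eq_col_mx[h1 h2] h3].
have rA y : B *m y = d -> r^T *m (A *m (x - y)) = 0.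
  move=> yd; rewrite mulmxA.
  have -> : r^T *m A = - (l^T *m B).
    apply: trmx_inj; rewrite linearN /= !trmx_mul !trmxK.
    by apply/eqP; rewrite -addr_eq0 h3.
  by rewrite mulNmx -mulmxA mulmxBr h2 yd subrr mulmx0 oppr0.
have res : b - A *m x = r by rewrite -h1 addrK.
have resy y : b - A *m y = r + A *m (x - y).
  by rewrite mulmxBr addrA h1.
have sqr_res y : B *m y = d ->
    norm2 (b - A *m y) ^+ 2 = norm2 (b - A *m x) ^+ 2 + norm2 (A *m (x - y)) ^+ 2.
  by move=> /rA yd; rewrite resy res sqr_norm2D_orth.
apply: xget_unique.
  split=> // y yd; rewrite -(@ler_pXn2r _ 2)// ?nnegrE ?norm2_ge0//.
  by rewrite (sqr_res y)// lerDl sqr_ge0.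
move=> y [yd ymin].
have Axy : A *m (x - y) = 0.
  have := ymin _ h2; rewrite -(@ler_pXn2r _ 2)// ?nnegrE ?norm2_ge0//.
  rewrite (sqr_res y)// gerDl => h.
  by apply/eqP; rewrite -norm2_eq0 -sqrf_eq0 eq_le h sqr_ge0.
(* A second minimizer y would yield the kernel vector (0, 0, x - y). *)
have : kkt A B *m col_mx (col_mx 0 0) (x - y) = 0.
  by rewrite mul_kkt Axy mulmxBr h2 yd subrr !mulmx0 !addr0 !col_mx0.
move/(congr1 (mulmx (invmx (kkt A B)))); rewrite mulKmx// mulmx0 => /eqP.
by rewrite !col_mx_eq0 => /andP[_]; rewrite subr_eq0 => /eqP.
Qed.

Lemma lse_solE A B b d :
  kkt A B \in unitmx -> lse_sol A B b d = dsubmx (invmx (kkt A B) *m kkt_rhs n b d).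
Proof.
move=> Ku; set z := invmx _ *m _.
apply: (@lse_sol_kkt _ _ _ _ (usubmx (usubmx z)) (dsubmx (usubmx z))) => //.
by rewrite !vsubmxK mulKVmx.
Qed.

(** Substitute f = r + A x, g = B x and q = A^T r + B^T l on the right. The coefficients of r and l
    vanish by the two Gram identities; that of x is the identity since (AP)^+ A P = P. *)
Lemma kkt_solution A B (w : 'cV[R]_(m + s + n)) f g q :
  null A `&` null B = [set 0] ->
  let AP := A *m nullproj B in
  kkt A B *m w = col_mx (col_mx f g) q ->
  dsubmx w = mpinv AP *m f + mpinvBA A B *m g - mpinv (AP^T *m AP) *m q.
Proof.
move=> hAB AP; rewrite -[w]vsubmxK -[usubmx w]vsubmxK col_mxKd.
set r := usubmx (usubmx w); set l := dsubmx (usubmx w); set x := dsubmx w.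
rewrite mul_kkt => /eq_col_mx[/eq_col_mx[<- <-] <-].
have eA := mpinv_nullproj_gram_trA A B; have eB := mpinv_nullproj_gram_trB A B.
have eP := mpinv_nullproj_mul hAB.
rewrite /mpinvBA -/AP in eA eB eP *; clearbody AP.
rewrite !mulmxDr !mulmxA eA eB mul0mx addr0.
have -> : (1%:M - mpinv AP *m A) *m mpinv B *m B = 1%:M - mpinv AP *m A.
  have e : mpinv B *m B = 1%:M - nullproj B by rewrite /nullproj opprB addrC subrK.
  by rewrite -mulmxA e mulmxBr mulmx1 mulmxBl mul1mx eP subrr subr0.
by rewrite mulmxBl mul1mx addrCA !addrK.
Qed.

End Kkt.

(** * The Fréchet derivative of [lse_g] *)

Section Differential.
Variables (R : realType) (m n s k : nat) (L : 'M[R]_(n, k)).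
Variables (A : 'M[R]_(m, n)) (B : 'M[R]_(s, n)) (b : 'cV[R]_m) (d : 'cV[R]_s).
Hypotheses (hB : \rank B = s) (hAB : null A `&` null B = [set 0]).

Local Notation V := ('M[R]_(m, n) * 'M[R]_(s, n) * 'cV[R]_m * 'cV[R]_s)%type.

Let K := kkt A B.
Let z := invmx K *m kkt_rhs n b d.

Let Ku : K \in unitmx. Proof. exact: kkt_unit. Qed.

Let e (p : V) := kkt_rhs n p.1.2 p.2.
Let E (p : V) := kkt_dir p.1.1.1 p.1.1.2.

(** The candidate derivative: the first-order term of the solution of the system perturbed by [E p]
    and [e p], restricted to its x-block. *)
Let df (p : V) : 'cV[R]_k := L^T *m dsubmx (invmx K *m (e p - E p *m z)).

Let le_e p : `|e p| <= `|p|.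
Proof.
by rewrite !normr_col_mx ?normr0// !prod_normE !le_max lexx ?orbT.
Qed.

Let le_E p : `|E p| <= `|p|.
Proof.
case: p => [[[dA dB] db] dd]; rewrite /E /=.
have hA : `|dA| <= `|((dA, dB, db, dd) : V)| by rewrite !prod_normE !le_max lexx.
have hB' : `|dB| <= `|((dA, dB, db, dd) : V)| by rewrite !prod_normE !le_max lexx !orbT.
rewrite normr_col_mx// ?normr_row_mx ?normr0 ?normr_col_mx//.
- exact: le_trans (normr_trmx _) _.
- exact: le_trans (normr_trmx _) _.
Qed.

Let df_linear : linear df.
Proof.
move=> a [[[dA dB] db] dd] [[[dA' dB'] db'] dd']; rewrite /df /e /E /=.
rewrite scalemxAr -mulmxDr -linearP /= scalemxAr -mulmxDr.
congr (_ *m dsubmx (_ *m _)).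
rewrite scalerBr addrACA -opprD scalemxAl -mulmxDl; congr (_ - (_ *m z)).
  by rewrite /kkt_rhs !scale_col_mx !add_col_mx scaler0 addr0.
rewrite /kkt_dir scale_block_mx add_block_mx !scaler0 !addr0.
by rewrite scale_col_mx add_col_mx scale_row_mx add_row_mx !linearP.
Qed.

Let dfL : {linear V -> 'cV[R]_k} :=
  HB.pack df (GRing.isLinear.Build R V 'cV[R]_k *:%R df df_linear).

Let df_bounded : exists c, forall p, `|df p| <= c * `|p|.
Proof.
(* The constant stays open until the chained estimates determine it. *)
eexists => p; apply: le_trans (normr_mulmx _ _) _.
apply: le_trans (ler_wpM2l _ (normr_dsubmx _)) _; first by rewrite mulr_ge0.
apply: le_trans (ler_wpM2l _ (normr_mulmx _ _)) _; first by rewrite mulr_ge0.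
apply: le_trans (ler_wpM2l _ (ler_wpM2l _ (_ : _ <= (1 + (m + s + n)%:R * `|z|) * `|p|))) _.
- by rewrite mulr_ge0.
- by rewrite mulr_ge0.
- apply: le_trans (ler_normB _ _) _; rewrite mulrDl mul1r lerD ?le_e//.
  apply: le_trans (normr_mulmx _ _) _; rewrite mulrAC.
  by rewrite ler_wpM2l ?mulr_ge0 ?le_E.
by rewrite !mulrA.
Qed.

Let df_continuous : continuous dfL.
Proof.
apply: bounded_linear_continuous; apply/linear_boundedP.
have [c hc] := df_bounded.
near=> r => p; apply: le_trans (hc p) _.
by rewrite ler_wpM2r//; near: r; exact: nbhs_pinfty_ge.
Unshelve. all: by end_near. Qed.

Let lse_g_expansion :
  lse_g L \o shift ((A, B, b, d) : V) = cst (lse_g L (A, B, b, d)) + dfL +o_ (0 : V) id.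
Proof.
have [c c0 hc] := linear_system_perturbation z Ku.
pose q : R := n%:R * `|L^T| * c.
have q0 : 0 <= q by rewrite !mulr_ge0// ltW.
have dsubmxB (u v w : 'cV[R]_(m + s + n)) :
    dsubmx u - (dsubmx v - dsubmx w) = dsubmx (u - (v - w)) by rewrite !linearB.
(* For such [p] the perturbed matrix is still invertible, so [lse_solE] applies at both points and
   the remainder is quadratic. *)
have rem (p : V) : c * `|p| <= 1 ->
    `|df p - (lse_g L (p + (A, B, b, d)) - lse_g L (A, B, b, d))| <= q * `|p| ^+ 2.
  move=> pc; have [KEu err] := hc _ _ _ (le_E p) (le_e p) pc.
  case: p pc KEu err => [[[dA dB] db] dd] pc KEu err.
  have KE : kkt (dA + A) (dB + B) = K + E (dA, dB, db, dd) by exact: kktD.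
  rewrite /df -[lse_g L (A, B, b, d)]/(L^T *m lse_sol A B b d).
  rewrite -[lse_g L _]/(L^T *m lse_sol (dA + A) (dB + B) (db + b) (dd + d)).
  rewrite !lse_solE ?KE// -/z -!mulmxBr dsubmxB.
  apply: le_trans (normr_mulmx _ _) _.
  apply: le_trans (ler_wpM2l _ (normr_dsubmx _)) _; first by rewrite mulr_ge0.
  rewrite /q -!mulrA !ler_wpM2l// distrC -addrA -opprD.
  apply: err; rewrite mulKVmx// mulKVmx// /e /kkt_rhs /=.
  by rewrite !add_col_mx addr0 ![_ + b]addrC ![_ + d]addrC.
apply/eqaddoP => eps eps0; near=> p.
have pc : c * `|p| <= 1.
  rewrite -ler_pdivlMl// mulr1; near: p.
  by apply: (@nbhs0_le _ V); rewrite invr_gt0.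
have pq : q * `|p| <= eps.
  (* Since [q] may be 0, the radius is [eps / (q + 1)]. *)
  rewrite (@le_trans _ _ ((q + 1) * `|p|))// ?ler_wpM2r ?lerDl//.
  rewrite -ler_pdivlMl ?ltr_wpDl// mulrC; near: p.
  by apply: (@nbhs0_le _ V); rewrite divr_gt0// ltr_wpDl.
have := rem p pc; rewrite distrC => h.
rewrite -[X in `|X|]/(lse_g L (p + (A, B, b, d)) - (lse_g L (A, B, b, d) + df p)).
rewrite opprD addrA; apply: le_trans h _.
by rewrite expr2 mulrA ler_wpM2r.
Unshelve. all: by end_near. Qed.

(** The block formula of [kkt_solution] is applied to the right-hand side (db - dA x, dd - dB x, -
    dA^T r - dB^T l), and the multiplier l is then expressed through r. *)
Lemma diff_lse_g (p : V) :
  let AP := A *m nullproj B in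
  let BA := mpinvBA A B in
  let x := lse_sol A B b d in
  let r := b - A *m x in
  'd (lse_g L) ((A, B, b, d) : V) p =
  L^T *m (mpinv AP *m (p.1.2 - p.1.1.1 *m x) + BA *m (p.2 - p.1.1.2 *m x) +
    mpinv (AP^T *m AP) *m (p.1.1.1^T *m r - p.1.1.2^T *m (BA^T *m A^T *m r))).
Proof.
move=> AP BA x r.
rewrite (diff_unique df_continuous lse_g_expansion) /= /df; congr (_ *m _).
set l := dsubmx (usubmx z).
have xE : dsubmx z = x by rewrite /x lse_solE.
have : K *m z = kkt_rhs n b d by rewrite mulKVmx.
rewrite -[z]vsubmxK -[usubmx z]vsubmxK xE mul_kkt => /eq_col_mx[/eq_col_mx[h1 h2] h3].
have rE : usubmx (usubmx z) = r by rewrite /r -h1 addrK.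
rewrite rE in h3 *; rewrite -/l in h3 *.
(* The transpose of [BA] is applied to A^T r = - B^T l; it inverts B^T because [BA] is a right
   inverse of [B]. *)
have lE : BA^T *m A^T *m r = - l.
  have hAr : A^T *m r = - (B^T *m l) by apply/eqP; rewrite -addr_eq0 h3.
  have BB : B *m mpinv B = 1%:M.
    have Bf : row_free B by rewrite /row_free hB.
    have [e1 _ _ _] := mpinvP B.
    by apply: (row_free_inj Bf); rewrite e1 mul1mx.
  have BBA : B *m BA = 1%:M.
    rewrite /BA /mpinvBA mulmxA mulmxBr mulmx1 mulmxA.
    (* Writing (AP)^+ as P (AP)^+ makes its product with [B] vanish. *)
    by rewrite -nullproj_mpinv !mulmxA nullproj_mulB !mul0mx subr0.
  by rewrite -mulmxA hAr mulmxN mulmxA -trmx_mul BBA trmx1 mul1mx.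
have := kkt_solution (w := invmx K *m (e p - E p *m col_mx (col_mx r l) x)) hAB.
rewrite -/K mulKVmx// mul_kkt_dir /e /kkt_rhs opp_col_mx opp_col_mx !add_col_mx sub0r.
by move=> /(_ _ _ _ erefl) ->; rewrite -/AP -/BA lE !mulmxN !opprK.
Qed.

End Differential.

(** * Vectorization and the matrix of the derivative *)

(** The identity vec(C Y D) = (D^T ⊗ C) vec Y for a single column D = u^T, where the outer vec is
    trivial. *)
Lemma kron_row_vec (R : realType) (p q k : nat) (u : 'rV[R]_p) (C : 'M[R]_(k, q))
    (Y : 'M[R]_(q, p)) :
  kron_row u C *m vec Y = C *m Y *m u^T.
Proof.
apply/matrixP => i j; rewrite ord1 !mxE.
under [RHS]eq_bigr do rewrite !mxE mulr_suml.
rewrite pair_bigA (reindex (@mxtens_index p q)) /=; last first.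
  by exists (@mxtens_unindex p q) => l _; rewrite ?mxtens_indexK ?mxtens_unindexK.
apply: eq_bigr => -[a c] _; rewrite !mxE mxtens_indexK /= castmxE /= cast_ord_id.
have -> : cast_ord (esym (mul1n k)) i = mxtens_index (0 : 'I_1, i).
  by apply: val_inj.
by rewrite tensmxE [RHS]mulrC mulrA.
Qed.

Lemma vec0 (R : realType) (p q : nat) : vec (0 : 'M[R]_(p, q)) = 0.
Proof. by apply/matrixP => i j; rewrite !mxE. Qed.

Lemma vec_eq0 (R : realType) (p q : nat) (Y : 'M[R]_(p, q)) : vec Y = 0 -> Y = 0.
Proof.
move=> Y0; apply/matrixP => i j; rewrite mxE.
by move/matrixP/(_ (mxtens_index (j, i)) 0): Y0; rewrite !mxE mxtens_indexK.
Qed.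

Lemma vec_surj (R : realType) (p q : nat) (v : 'cV[R]_(q * p)) :
  exists Y : 'M[R]_(p, q), vec Y = v.
Proof.
exists (\matrix_(i, j) v (mxtens_index (j, i)) 0); apply/matrixP => k j.
by rewrite ord1 !mxE -surjective_pairing mxtens_unindexK.
Qed.

Lemma norm2_vec (R : realType) (p q : nat) (Y : 'M[R]_(p, q)) : norm2 (vec Y) = normF Y.
Proof.
congr Num.sqrt; rewrite exchange_big /= pair_bigA /=.
rewrite (reindex (@mxtens_index q p)) /=; last first.
  by exists (@mxtens_unindex q p) => k' _; rewrite ?mxtens_indexK ?mxtens_unindexK.
by apply: eq_bigr => -[j i] _; rewrite mxE mxtens_indexK.
Qed.

Lemma sqr_norm2_col_mx (R : realType) (p q : nat) (u : 'cV[R]_p) (v : 'cV[R]_q) :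
  norm2 (col_mx u v) ^+ 2 = norm2 u ^+ 2 + norm2 v ^+ 2.
Proof. by rewrite !sqr_norm2 tr_col_mx mul_row_col mxE. Qed.

(** [S], [X] and [Y] stand for ((AP)^T AP)^+, (AP)^+ and B_A^+. The weights cancel, the
    vec-permutations transpose [dA] and [dB], and [kron_row_vec] undoes the Kronecker products. *)
Lemma condition_matrix_mul (R : realType) (m n s k : nat)
    (L : 'M[R]_(n, k)) (S : 'M[R]_n) (X : 'M[R]_(n, m)) (Y : 'M[R]_(n, s))
    (A : 'M[R]_(m, n)) (x : 'cV[R]_n) (r : 'cV[R]_m) (aA aB ab ad : R)
    (dA : 'M[R]_(m, n)) (dB : 'M[R]_(s, n)) (db : 'cV[R]_m) (dd : 'cV[R]_s) :
  0 < aA -> 0 < aB -> 0 < ab -> 0 < ad ->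
  row_mx (row_mx (row_mx
    (aA^-1 *: (kron_row r^T (L^T *m S) *m vec_perm R m n - kron_row x^T (L^T *m X)))
    (- (aB^-1 *: (kron_row (r^T *m A *m Y) (L^T *m S) *m vec_perm R s n
                  + kron_row x^T (L^T *m Y)))))
    (ab^-1 *: (L^T *m X))) (ad^-1 *: (L^T *m Y)) *m
  col_mx (col_mx (col_mx (aA *: vec dA) (aB *: vec dB)) (ab *: db)) (ad *: dd) =
  L^T *m (X *m (db - dA *m x) + Y *m (dd - dB *m x) +
    S *m (dA^T *m r - dB^T *m (Y^T *m A^T *m r))).
Proof.
move=> haA haB hab had.
have inv_scale (c : R) p q (C : 'M[R]_(p, q)) (v : 'cV[R]_q) :
    0 < c -> (c^-1 *: C) *m (c *: v) = C *m v.
  by move=> c0; rewrite -scalemxAr -scalemxAl scalerA divff ?scale1r ?gt_eqF.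
rewrite !mul_row_col mulNmx !inv_scale//.
rewrite mulmxBl mulmxDl -!(mulmxA _ (vec_perm _ _ _)) !vec_permP !kron_row_vec.
rewrite !trmx_mul !trmxK !(mulmxDr, mulmxN) !mulmxA opprD !addrA.
by rewrite [RHS](ACl (5*2*6*4*1*3))%AC.
Qed.

(** * Identification of the condition number with the spectral norm *)

Theorem theorem2p1 (R : realType) (m n s k : nat)
    (hmsn : (n <= m + s)%N) (hns : (s <= n)%N) (hk : (k <= n)%N)
    (A : 'M[R]_(m, n)) (B : 'M[R]_(s, n)) (b : 'cV[R]_m) (d : 'cV[R]_s)
    (hB : \rank B = s) (hAB : null A `&` null B = [set 0])
    (L : 'M[R]_(n, k)) (aA aB ab ad : R)
    (haA : 0 < aA) (haB : 0 < aB) (hab : 0 < ab) (had : 0 < ad) :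
  let AP := A *m nullproj B in
  let BA := mpinvBA A B in
  let x := lse_sol A B b d in
  let r := b - A *m x in
  let M1 := aA^-1 *:
    (kron_row r^T (L^T *m mpinv (AP^T *m AP)) *m vec_perm R m n
     - kron_row x^T (L^T *m mpinv AP)) in
  let M2 := - (aB^-1 *:
    (kron_row (r^T *m A *m BA) (L^T *m mpinv (AP^T *m AP)) *m vec_perm R s n
     + kron_row x^T (L^T *m BA))) in
  let M3 := ab^-1 *: (L^T *m mpinv AP) in
  let M4 := ad^-1 *: (L^T *m BA) in
  kappa_LSE L aA aB ab ad A B b d =
  specnorm (row_mx (row_mx (row_mx M1 M2) M3) M4).
Proof.
move=> AP BA x r M1 M2 M3 M4; set M := row_mx _ M4.
pose V := ('M[R]_(m, n) * 'M[R]_(s, n) * 'cV[R]_m * 'cV[R]_s)%type.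
pose w (p : V) : 'cV[R]_(n * m + n * s + m + s) :=
  col_mx (col_mx (col_mx (aA *: vec p.1.1.1) (aB *: vec p.1.1.2)) (ab *: p.1.2)) (ad *: p.2).
have diffE p : 'd (lse_g L) (A, B, b, d) p = M *m w p.
  by rewrite (diff_lse_g L b d hB hAB p) /M condition_matrix_mul.
have normE p : norm2 (w p) = wnormF aA aB ab ad p.
  case: p => [[[dA dB] db] dd]; rewrite /w /wnormF /=.
  rewrite -[LHS]ger0_norm ?norm2_ge0// -sqrtr_sqr !sqr_norm2_col_mx !norm2Z !exprMn.
  by rewrite !norm2_vec !real_normK ?num_real.
(* Positive weights make the weighted vectorization injective, so that nonzero directions correspond
   to nonzero vectors. *)
have w0 p : (w p == 0) = (p == 0).
  case: p => [[[dA dB] db] dd]; rewrite /w /= !col_mx_eq0 !scaler_eq0 !gt_eqF//=.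
  apply/idP/eqP => [/andP[/andP[/andP[]]]|[-> -> -> ->]]; last by rewrite !vec0 !eqxx.
  by move=> /eqP/vec_eq0 -> /eqP/vec_eq0 -> /eqP -> /eqP ->.
have w_surj v : exists p, w p = v.
  have scale_inv (c : R) q (u : 'cV[R]_q) : 0 < c -> c *: (c^-1 *: u) = u.
    by move=> c0; rewrite scalerA divff ?scale1r ?gt_eqF.
  have [dA eA] := vec_surj (aA^-1 *: usubmx (usubmx (usubmx v))).
  have [dB eB] := vec_surj (aB^-1 *: dsubmx (usubmx (usubmx v))).
  exists (dA, dB, ab^-1 *: dsubmx (usubmx v), ad^-1 *: dsubmx v).
  by rewrite /w /= eA eB !scale_inv// !vsubmxK.
(* The two sets of quotients coincide; this also covers the case where both are empty and [max_of]
   takes its default value 0. *)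
rewrite /kappa_LSE /specnorm; congr max_of; apply/seteqP; split.
  move=> _ [p /= p0 <-]; exists (w p); first by rewrite /= w0.
  by rewrite normE diffE.
move=> _ [v /= v0 <-]; have [p pv] := w_surj v; exists p.
  by rewrite /= -w0 pv.
by rewrite -normE diffE pv.
Qed.
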